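(* Let $G$ be an uncountable Polish group and let $A\subseteq G$ be a universally measurable set such that $A^{-1}A=\{a^{-1}b: a,b\in A\}$ is meager in $G$. Then the set \[ T_l(A)=\{\mu\in P(G): \mu(gA)=0 \text{ for all } g\in G\} \] is co-meager in $P(G)$. Consequently, if $A\subseteq G$ is analytic and not generically left Haar-null (in particular, if $A$ is not left Haar-null), then $A^{-1}A$ is non-meager.
   Context: For a Polish space $X$, $P(X)$ denotes the space of all Borel probability measures on $X$ with the weak* topology (a Polish space). For a Polish group $G$ and a universally measurable set $A\subseteq G$: $A$ is called left Haar-null if there exists $\mu\in P(G)$ with $\mu(gA)=0$ for all $g\in G$; $A$ is called generically left Haar-null if the set $T_l(A)=\{\mu\in P(G): \mu(gA)=0 \text{ for all } g\in G\}$ is co-meager in $P(G)$. A subset of a Polish space is analytic if it is the image of $\mathbb{N}^{\mathbb{N}}$ under a continuous map. *)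

(* Defs.v *)
From HB Require Import structures.
From mathcomp Require Import all_boot all_order all_algebra.
From mathcomp Require Import all_classical all_reals all_analysis.
Set Implicit Arguments. Unset Strict Implicit. Unset Printing Implicit Defensive.
Import Order.TTheory GRing.Theory Num.Theory.
Import numFieldNormedType.Exports.
Local Open Scope classical_set_scope.
Local Open Scope ring_scope.

Section Category.
Context {T : Type} (op : set (set T)).

Definition nowhere_dense_in (N : set T) : Prop :=
  forall U, op U -> U !=set0 ->
    exists V, [/\ op V, V !=set0, V `<=` U & V `&` N = set0].

Definition meager_in (A : set T) : Prop :=
  exists N : nat -> set T, (forall n, nowhere_dense_in (N n)) /\
    A `<=` \bigcup_n N n.

Definition comeager_in (A : set T) : Prop := meager_in (~` A).
End Category.

Section Polish.
Context (R : realType) (T : topologicalType).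

Definition is_metric (d : T -> T -> R) : Prop :=
  [/\ forall x y, 0 <= d x y,
      forall x y, d x y = 0 <-> x = y,
      forall x y, d x y = d y x &
      forall x y z, d x z <= d x y + d y z].

Definition metric_compatible (d : T -> T -> R) : Prop :=
  forall U : set T, open U <->
    (forall x, U x -> exists2 eps : R, 0 < eps & [set y | d x y < eps] `<=` U).

Definition metric_complete (d : T -> T -> R) : Prop :=
  forall u : nat -> T,
    (forall eps : R, 0 < eps -> exists N : nat,
        forall m n, (N <= m)%N -> (N <= n)%N -> d (u m) (u n) < eps) ->
    exists l : T, u @ \oo --> l.

Definition separable_space : Prop :=
  exists D : set T, countable D /\ dense D.

Definition polish_space : Prop :=
  separable_space /\
  exists d : T -> T -> R, [/\ is_metric d, metric_compatible d & metric_complete d].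
End Polish.

Section PolishGroup.
Context (R : realType) (G : ptopologicalType)
  (mul : G -> G -> G) (inv : G -> G) (e : G).

Definition is_group : Prop :=
  [/\ forall x y z, mul x (mul y z) = mul (mul x y) z,
      forall x, mul e x = x, forall x, mul x e = x,
      forall x, mul (inv x) x = e & forall x, mul x (inv x) = e].

Definition polish_group : Prop :=
  [/\ is_group,
      continuous (fun p : G * G => mul p.1 p.2),
      continuous inv &
      polish_space R G].
End PolishGroup.

Notation Borel G := (g_sigma_algebraType (@open G)).

Notation PMeas G R := (probability (Borel G) R).

Section Measures.
Context (R : realType) (G : ptopologicalType).

Definition bounded_continuous (f : G -> R) : Prop :=
  continuous f /\ exists M : R, forall x, `|f x| <= M.

(* Open sets of the weak* topology on P(G): the topology generated by the
   maps mu |-> \int f dmu, f bounded continuous. *)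
Definition weak_open (U : set (PMeas G R)) : Prop :=
  forall mu : PMeas G R, U mu ->
    exists (n : nat) (f : nat -> G -> R) (eps : R),
      [/\ 0 < eps, forall i, (i < n)%N -> bounded_continuous (f i) &
          [set nu : PMeas G R | forall i, (i < n)%N ->
             (`| \int[nu]_x (f i x)%:E - \int[mu]_x (f i x)%:E | < eps%:E)%E]
          `<=` U].

(* universally measurable: measurable for the completion of every Borel
   probability measure *)
Definition univ_measurable (A : set G) : Prop :=
  forall mu : PMeas G R, exists B1 B2 : set (Borel G),
    [/\ measurable B1, measurable B2, B1 `<=` A, A `<=` B2 &
        mu (B2 `\` B1) = 0%E].
End Measures.

Section HaarNull.
Context (R : realType) (G : ptopologicalType) (mul : G -> G -> G) (inv : G -> G).

Definition ltrans (g : G) (A : set G) : set G := (mul g) @` A.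

Definition diffset (A : set G) : set G :=
  [set x | exists a b, [/\ A a, A b & x = mul (inv a) b]].

(* T_l(A) = {mu in P(G) | mu(gA) = 0 for all g}  (mu completed) *)
Definition T_l (A : set G) : set (PMeas G R) :=
  [set mu | forall g : G, mu.-negligible (ltrans g A : set (Borel G))].

Definition left_haar_null (A : set G) : Prop :=
  univ_measurable R A /\ exists mu : PMeas G R, T_l A mu.

Definition gen_left_haar_null (A : set G) : Prop :=
  univ_measurable R A /\ comeager_in (@weak_open R G) (T_l A).
End HaarNull.

Definition baire_space : Type := prod_topology (fun _ : nat => nat).

Definition analytic (G : topologicalType) (A : set G) : Prop :=
  exists f : baire_space -> G, continuous f /\ range f = A.

(* Main.v *)
Require Import Defs.
From HB Require Import structures.
From mathcomp Require Import all_boot all_order all_algebra.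
From mathcomp Require Import all_classical all_reals all_analysis.
From mathcomp Require Import measurable_realfun.
From mathcomp Require Import lra.
Set Implicit Arguments.
Unset Strict Implicit.
Unset Printing Implicit Defensive.
Import Order.TTheory GRing.Theory Num.Theory.
Import numFieldNormedType.Exports.
Local Open Scope classical_set_scope.
Local Open Scope ring_scope.

(** Call a measure spread at scale [(N, eps)] if there are finitely many open sets [V_a]
such that [V_a^-1 V_b] misses [N] for [a <> b] and, for every [a], all but [eps] of the
mass lies in the union of the [V_b] with [b <> a].  Cover [A^-1 A] by an increasing
sequence of nowhere dense sets [N_n].  If [mu] is spread at all scales [(N_n, 1/(n+1))],
then almost no pair of points has its quotient in the union of the [N_n], whereas all
pairs of points of [gA] do; hence [gA] is [mu]-null.

The measures spread at a given scale contain a dense weak* open set: replace [mu] by a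
measure which divides the mass of each cell of a fine finite partition equally among
many points, chosen close to the cell and in general position with respect to [N].  This
gives comeagerness.  A measure which is spread at all scales is the image of Lebesgue
measure under a Cantor scheme of open sets in general position, so no Baire category
theorem for P(G) is needed.  Universal measurability of analytic sets is Lusin's
theorem, proved by approximation from inside. *)

(** * Bounds on outer measure *)

Section Covered.
Context d (T : measurableType d) (R : realType).
Implicit Types (mu : {measure set T -> \bar R}) (A : set T).

(** The outer measure of [A] is at most [c], expressed by a measurable hull so that [A] itself may
    be arbitrary. *)
Definition covered mu (c : \bar R) A :=
  exists B, [/\ measurable B, A `<=` B & (mu B <= c)%E].

Lemma coveredS mu c A A' : A `<=` A' -> covered mu c A' -> covered mu c A.
Proof. by move=> AA' [B [mB A'B Bc]]; exists B; split=> //; apply: subset_trans A'B. Qed.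

(** Continuity of outer measure from below. The hulls [B n] need not increase, but the tail
    intersections [C n] do, and they still contain [A n] because the [A n] increase. *)
Lemma covered_bigcup mu c (A : nat -> set T) : nondecreasing_seq A ->
  (forall n, covered mu c (A n)) -> covered mu c (\bigcup_n A n).
Proof.
move=> ndA /choice[B HB].
pose C n := \bigcap_(m in [set m | (n <= m)%N]) B m.
have mC n : measurable (C n).
  by apply: bigcap_measurable => [|m _]; [exists n => /=|have [] := HB m].
have mUC : measurable (\bigcup_n C n) by exact: bigcupT_measurable.
have ndC : nondecreasing_seq C.
  move=> m n mn; apply/subsetPset => x Cx k /= nk.
  by apply: Cx => /=; apply: leq_trans nk.
exists (\bigcup_n C n); split=> //.
  move=> x [n _ Anx]; exists n => // m /= nm.
  have [_ AB _] := HB m; apply: AB.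
  by move/subsetPset: (ndA _ _ nm); apply.
apply: (cvge_le _ (nondecreasing_cvg_mu mC mUC ndC)).
apply: nearW => n; have [mB _ Bc] := HB n.
by apply: le_trans Bc; apply: le_measure; rewrite ?inE //; apply: bigcap_inf => /=.
Qed.

Lemma negligible_covered mu A :
  (forall eps : R, 0 < eps -> covered mu eps%:E A) -> mu.-negligible A.
Proof.
move=> Acov.
have /choice[B HB] : forall n : nat, exists B,
    [/\ measurable B, A `<=` B & (mu B <= n.+1%:R^-1%:E)%E].
  by move=> n; apply: Acov; rewrite invr_gt0.
have mB : measurable (\bigcap_n B n).
  by apply: bigcapT_measurable => n; have [] := HB n.
exists (\bigcap_n B n); split=> //; last first.
  by move=> x Ax n _; have [_ AB _] := HB n; apply: AB.
apply/eqP; rewrite eq_le measure_ge0 andbT.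
apply/lee_addgt0Pr => eps eps0; rewrite add0e.
have [n _ /(_ n (leqnn n)) /= neps] := near_infty_natSinv_lt (PosNum eps0).
have [mBn _ Bn] := HB n.
apply: (@le_trans _ _ (mu (B n))).
  by apply: le_measure; rewrite ?inE //; apply: bigcap_inf.
by apply: le_trans Bn _; rewrite lee_fin ltW.
Qed.

End Covered.

(** * Balls of a compatible metric *)

Section CompatibleMetric.
Context (R : realType) (G : topologicalType) (d : G -> G -> R).
Hypotheses (dmet : is_metric d) (dcomp : metric_compatible d).

Let d0 x : d x x = 0. Proof. by have [_ H _ _] := dmet; apply/H. Qed.

Lemma open_mball x r : open [set y | d x y < r].
Proof.
have [_ _ _ dT] := dmet.
apply/dcomp => y /= dxy; exists (r - d x y); first by rewrite subr_gt0.
by move=> z /= dyz; apply: le_lt_trans (dT x y z) _; rewrite -ltrBrDl.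
Qed.

Lemma nbhs_mball x r : 0 < r -> nbhs x [set y | d x y < r].
Proof. by move=> r0; apply: open_nbhs_nbhs; split; [exact: open_mball|rewrite /= d0]. Qed.

Lemma cvg_mball (u : nat -> G) l : u @ \oo --> l ->
  forall eps, 0 < eps -> exists N : nat, forall n, (N <= n)%N -> d l (u n) < eps.
Proof. by move=> ul eps /(nbhs_mball l) /ul [N _ HN]; exists N => n Nn; apply: HN. Qed.

Lemma continuous_mdist x : continuous (d x : G -> R).
Proof.
have [dge _ dC dT] := dmet.
move=> y; apply/cvgrPdist_lt => eps eps0; near=> z.
have dyz : d y z < eps by near: z; exact: nbhs_mball.
rewrite ltr_norml; apply/andP; split.
  rewrite ltrNl opprB ltrBlDl.
  by apply: le_lt_trans (dT x y z) _; rewrite ltrD2l.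
by rewrite ltrBlDl; apply: le_lt_trans (dT x z y) _; rewrite ltrD2l dC.
Unshelve. all: by end_near. Qed.

End CompatibleMetric.

(** * Dependent choice and Koenig's lemma *)

Lemma prefix_choice (T : choiceType) (P : seq T -> Prop) :
  P [::] -> (forall s, P s -> exists v, P (rcons s v)) ->
  exists z : nat -> T, forall k, P (mkseq z k).
Proof.
move=> P0 PS.
(* [v0] is a default value, making [g] total on sequences that fail [P]. *)
have [v0 _] := PS _ P0.
have /choice[g Hg] : forall s, exists v, P s -> P (rcons s v).
  by move=> s; have [/PS[v ?]|?] := pselect (P s); [exists v|exists v0].
pose Z k := iter k (fun s => rcons s (g s)) [::].
exists (g \o Z) => k.
have -> : mkseq (g \o Z) k = Z k by elim: k => //= k IH; rewrite mkseqS IH.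
by elim: k => //= k /Hg.
Qed.

(** Koenig's lemma for the finitely branching tree below [m]: [P s] says that infinitely many [x k]
    begin with [s], and such an [s] has an extension of the same kind. *)
Lemma bounded_branch (x : nat -> nat -> nat) (m : nat -> nat) :
  (forall k i, (i < k)%N -> (x k i <= m i)%N) ->
  exists z : nat -> nat, forall n, exists2 k, (n <= k)%N &
    forall i, (i < n)%N -> x k i = z i.
Proof.
move=> xm.
pose P s := forall N, exists2 k, (N <= k)%N &
  forall i, (i < size s)%N -> x k i = nth 0%N s i.
have [|s Ps|z Pz] := @prefix_choice nat P.
- by move=> N; exists N.
- apply: contrapT => /forallNP Hn.
  have /choice[N HN] : forall v, exists N, forall k, (N <= k)%N ->
      (forall i, (i < size s)%N -> x k i = nth 0%N s i) -> x k (size s) <> v.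
    move=> v; have /existsNP[N HN] := Hn v; exists N => k Nk xs xv; apply: HN.
    exists k => // i; rewrite size_rcons ltnS leq_eqVlt nth_rcons.
    by case/predU1P => [->|ik]; rewrite ?ltnn ?eqxx// ik xs.
  (* Pigeonhole: past every [N v] with [v <= m (size s)] no value is left for [x k (size s)]. The
     bound [(size s).+1] makes [xm] apply at index [size s]. *)
  have [k] := Ps (maxn (size s).+1 (\max_(v < (m (size s)).+1) N v)).
  rewrite geq_max => /andP[sk Nk] xs.
  have xv : (x k (size s) < (m (size s)).+1)%N by rewrite ltnS xm.
  apply: (HN _ k _ xs erefl).
  by apply: leq_trans Nk; rewrite -[x k _]/(nat_of_ord (Ordinal xv)) leq_bigmax.
- exists z => n; have [k nk xz] := Pz n n; exists k => // i ltin.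
  by rewrite xz ?size_mkseq// nth_mkseq.
Qed.

(** * Lusin's theorem on analytic sets *)

Section Lusin.
Context (R : realType) (G : ptopologicalType) (d : G -> G -> R).
Hypotheses (dmet : is_metric d) (dcomp : metric_compatible d).

Let box (s : seq nat) : set baire_space :=
  [set x | forall i, (i < size s)%N -> (x i <= nth 0 s i)%N].

Lemma measurable_open (U : set G) : open U -> measurable (U : set (Borel G)).
Proof. by move=> oU; exact: sub_gen_smallest. Qed.

Lemma measurable_closed (U : set G) : closed U -> measurable (U : set (Borel G)).
Proof.
move=> cU; have /measurableC : measurable (~` U : set (Borel G)).
  by apply: measurable_open; exact: closed_openC.
by rewrite setCK.
Qed.

Lemma cvg_baire_space (u : nat -> baire_space) (z : baire_space) :
  (forall n i, (i < n)%N -> u n i = z i) -> u @ \oo --> z.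
Proof.
move=> uz; apply/cvg_sup => i A; rewrite nbhsE => -[B [[C oC <-] Cz] BA].
by exists i.+1 => // n /= ltin; apply: BA; rewrite /= /proj uz.
Qed.

(** Compactness of the set of sequences dominated by [m]: a point [y] of all the closures is
    approximated by [f (x k)] with [x k] bounded by [m] on its first [k] coordinates. Koenig's lemma
    extracts a subsequence converging to some [z], and [f z = y] by continuity. *)
Lemma closed_boxes_sub_range (f : baire_space -> G) (m : nat -> nat) :
  continuous f -> \bigcap_k closure (f @` box (mkseq m k)) `<=` range f.
Proof.
move=> cf y Cy; have [dge d0 dC dT] := dmet.
have /choice[x Hx] : forall k : nat, exists x : baire_space,
    box (mkseq m k) x /\ d y (f x) < k.+1%:R^-1.
  move=> k; have := Cy k I.
  have /(nbhs_mball dmet dcomp y) yk : 0 < k.+1%:R^-1 :> R by rewrite invr_gt0.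
  by move=> /(_ _ yk)[_ [[x bx <-] /= dyx]]; exists x.
have [z Hz] : exists z : nat -> nat, forall n, exists2 k, (n <= k)%N &
    forall i, (i < n)%N -> x k i = z i.
  apply: (@bounded_branch _ m) => k i ik.
  by have [/(_ i) + _] := Hx k; rewrite size_mkseq nth_mkseq//; apply.
exists z => //; apply/esym/d0/eqP; rewrite eq_le dge andbT.
have /choice[k Hk] : forall n, exists k, (n <= k)%N /\ forall i, (i < n)%N -> x k i = z i.
  by move=> n; have [k ? ?] := Hz n; exists k.
have fxz : (f \o x \o k) @ \oo --> f z.
  have xkz : (fun n => x (k n) : baire_space) @ \oo --> (z : baire_space).
    by apply: cvg_baire_space => n i ltin; rewrite (Hk n).2.
  exact: (cvg_comp _ _ xkz (cf z)).
apply/ler_addgt0Pr => eps eps0; rewrite add0r.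
have e2 : 0 < eps / 2 by rewrite divr_gt0.
have [N HN] := cvg_mball dmet dcomp fxz e2.
have [M _ HM] := near_infty_natSinv_lt (PosNum e2).
pose n := maxn N M.
apply: le_trans (dT y (f (x (k n))) (f z)) _.
rewrite [eps]splitr lerD// ltW//; last first.
  by rewrite dC; apply: HN; exact: leq_maxl.
apply: lt_trans (Hx (k n)).2 _; apply: HM => /=.
by apply: leq_trans (Hk n).1; exact: leq_maxr.
Qed.

(** The bounds [m i] are chosen one at a time: the image of [box s] is the increasing union of the
    images of [box (rcons s v)], so by [covered_bigcup] some [v] keeps it uncovered. The closures
    along [m] decrease and have measure at least [c], hence so has their intersection. *)
Lemma closed_approx (mu : PMeas G R) (f : baire_space -> G) c :
  continuous f -> ~ covered mu c (range f : set (Borel G)) ->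
  exists K, [/\ closed K, K `<=` range f & (c <= mu (K : set (Borel G)))%E].
Proof.
move=> cf ncov.
have [||m Hm] := @prefix_choice nat (fun s => ~ covered mu c (f @` box s : set (Borel G))).
- by apply: contra_not ncov; apply: coveredS => _ [x _ <-]; exists x.
- move=> s; apply: contra_notP => /forallNP Hs.
  apply: (@coveredS _ _ _ mu c _ (\bigcup_v (f @` box (rcons s v) : set (Borel G)))).
    move=> _ [x bx <-]; exists (x (size s)) => //; exists x => // i.
    by rewrite size_rcons ltnS nth_rcons; case: ltngtP => // [/bx|->].
  apply: covered_bigcup => [v w vw|v]; last by have /contrapT := Hs v.
  apply/subsetPset => _ [x bx <-]; exists x => // i.
  have := bx i; rewrite !size_rcons ltnS !nth_rcons.
  by case: ltngtP => // _ /(_ isT) /leq_trans xv _; apply: xv.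
have mC k : measurable (closure (f @` box (mkseq m k)) : set (Borel G)).
  by apply: measurable_closed; exact: closed_closure.
have cK : closed (\bigcap_k closure (f @` box (mkseq m k))).
  by apply: closed_bigI => k _; exact: closed_closure.
exists (\bigcap_k closure (f @` box (mkseq m k))); split => //.
  exact: closed_boxes_sub_range.
have mK := measurable_closed cK.
apply: (cvge_ge _ (nonincreasing_cvg_mu _ mC mK _)).
- apply: nearW => k /=; rewrite leNgt; apply/negP => /ltW Cc; apply: (Hm k).
  by exists (closure (f @` box (mkseq m k))); split=> //; exact: subset_closure.
- by apply: le_lt_trans (probability_le1 _ (mC _)) _; rewrite ltry.
- move=> k l kl; apply/subsetPset; apply: closureS => _ [x bx <-]; exists x => // i.
  rewrite size_mkseq => ik; have il := leq_trans ik kl.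
  by have := bx i; rewrite size_mkseq !nth_mkseq//; apply.
Qed.

Lemma analytic_univ_measurable (A : set G) : analytic A -> univ_measurable R A.
Proof.
move=> [f [cf <-]] mu; set A' := range f.
pose S := [set c | covered mu c (A' : set (Borel G))].
pose m := ereal_inf S.
have m0 : (0 <= m)%E.
  by apply: le_ereal_inf_tmp => c [B [_ _]]; apply: le_trans; exact: measure_ge0.
have m1 : (m <= 1)%E.
  by apply: ereal_inf_lbound; exists setT; split => //; exact: probability_le1.
have mfin : m \is a fin_num by rewrite ge0_fin_numE// (le_lt_trans m1)// ltry.
have /choice[B HB] : forall n : nat, exists B : set (Borel G),
    [/\ measurable B, A' `<=` B & (mu B <= m + n.+1%:R^-1%:E)%E].
  move=> n; have : (m < m + n.+1%:R^-1%:E)%E by rewrite lteDl// lte_fin invr_gt0.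
  move/ereal_inf_lt => [c [B [mB AB Bc]] cm]; exists B; split=> //.
  by apply: le_trans Bc _; exact: ltW.
have /choice[K HK] : forall n : nat, exists K : set (Borel G),
    [/\ measurable K, K `<=` A' & (m - n.+1%:R^-1%:E <= mu K)%E].
  (* As [m] is finite, [m - 1/(n+1)] is strictly below the infimum of [S], so the range of [f] is
     not covered at this level. *)
  move=> n; have [|K [cK KA Kc]] := @closed_approx mu f (m - n.+1%:R^-1%:E)%E cf.
    move=> Scn; have := @ereal_inf_lbound R S _ Scn; rewrite -/m leNgt => /negP; apply.
    by rewrite lteBlDr// lteDl// lte_fin invr_gt0.
  by exists K; split=> //; exact: measurable_closed.
have mK : measurable (\bigcup_n K n).
  by apply: bigcupT_measurable => n; have [] := HK n.
have mB : measurable (\bigcap_n B n).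
  by apply: bigcapT_measurable => n; have [] := HB n.
exists (\bigcup_n K n), (\bigcap_n B n); split=> //.
- by move=> x [n _ Kx]; have [_ KA _] := HK n; exact: KA.
- by move=> x Ax n _; have [_ AB _] := HB n; exact: AB.
apply/eqP; rewrite eq_le measure_ge0 andbT.
apply/lee_addgt0Pr => eps eps0; rewrite add0e.
have e2 : 0 < eps / 2 by rewrite divr_gt0.
have [n _ /(_ n (leqnn n)) /= neps] := near_infty_natSinv_lt (PosNum e2).
have [mBn ABn Bn] := HB n; have [mKn KnA Kn] := HK n.
apply: (@le_trans _ _ (mu (B n `\` K n))).
  apply: le_measure; rewrite ?inE//; try exact: measurableD.
  by move=> x [Bx Kx]; split; [exact: Bx|move=> Knx; apply: Kx; exists n].
rewrite measureD//; last by apply: le_lt_trans (probability_le1 _ _) _ => //; rewrite ltry.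
rewrite setIidr; last by move=> x /KnA /ABn.
rewrite leeBlDr; last exact: fin_num_measure.
apply: le_trans Bn _.
have : (m <= mu (K n) + n.+1%:R^-1%:E)%E by rewrite -leeBlDr.
move=> /(@leeD2r _ n.+1%:R^-1%:E) /le_trans; apply.
rewrite -addeA addeC leeD2r// -EFinD lee_fin [leRHS]splitr.
by rewrite lerD// ltW.
Qed.

End Lusin.

(** * Nowhere dense and meager sets *)

Section NowhereDense.
Context (T : Type) (op : set (set T)).

Lemma nowhere_dense_sub (A B : set T) :
  A `<=` B -> nowhere_dense_in op B -> nowhere_dense_in op A.
Proof.
move=> AB ndB U oU U0; have [V [oV V0 VU VB]] := ndB U oU U0.
exists V; split=> //; apply/seteqP; split=> // x [Vx /AB Bx].
by rewrite -VB.
Qed.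

Lemma nowhere_dense_setU (A B : set T) : nowhere_dense_in op A ->
  nowhere_dense_in op B -> nowhere_dense_in op (A `|` B).
Proof.
move=> ndA ndB U oU U0; have [V [oV V0 VU VA]] := ndA U oU U0.
have [W [oW W0 WV WB]] := ndB V oV V0.
exists W; split=> //; first exact: subset_trans VU.
by rewrite setIUr WB setU0; apply/seteqP; split=> // x [/WV Vx Ax]; rewrite -VA.
Qed.

Lemma meager_nondecreasing (A : set T) : meager_in op A ->
  exists N : nat -> set T, [/\ forall n, nowhere_dense_in op (N n),
    nondecreasing_seq N & A `<=` \bigcup_n N n].
Proof.
move=> [N [ndN AN]]; exists (fun n => \bigcup_(i in [set i | (i <= n)%N]) N i); split.
- elim=> [|n IH]; first by apply: nowhere_dense_sub (ndN 0%N) => x [i /=]; rewrite leqn0 => /eqP->.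
  apply: nowhere_dense_sub (nowhere_dense_setU IH (ndN n.+1)) => x [i /=].
  by rewrite leq_eqVlt => /predU1P[->|in_] Nx; [right|left; exists i].
- by move=> m n mn; apply/subsetPset => x [i /= im Nx]; exists i => //=; apply: leq_trans mn.
- by move=> x /AN [n _ Nx]; exists n => //; exists n => /=.
Qed.

End NowhereDense.

(** * Open sets in general position *)

Section Separation.
Context (G : ptopologicalType) (mul : G -> G -> G) (inv : G -> G) (e : G).
Hypotheses (grp : is_group mul inv e)
  (mulc : continuous (fun p : G * G => mul p.1 p.2)) (invc : continuous inv).

Lemma continuous_ltrans x : continuous (mul x).
Proof.
move=> y; apply: (@continuous_comp _ _ _ (fun z => (x, z)) (fun p : G * G => mul p.1 p.2)); last exact: mulc.
by apply: cvg_pair => /=; [exact: cvg_cst|exact: cvg_id].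
Qed.

(** Nowhere density is applied to [x^-1 V], the set of quotients [x^-1 y] with [y] in [V]. It
    contains an open [W] missing [N]; for [w] in [W], continuity of [(a, b) -> a^-1 b] at [(x, x w)]
    gives the two neighbourhoods. *)
Lemma separate2 (N U V : set G) : nowhere_dense_in open N ->
  open U -> U !=set0 -> open V -> V !=set0 ->
  exists U' V', [/\ open U' /\ U' !=set0, open V' /\ V' !=set0, U' `<=` U, V' `<=` V &
    forall x y, U' x -> V' y -> ~ N (mul (inv x) y)].
Proof.
have [mulA mul1 _ mulV mulxV] := grp.
move=> ndN oU [x Ux] oV [v Vv].
have oW : open (mul x @^-1` V).
  by apply: open_comp => // z _; exact: continuous_ltrans.
have [|W [oW' [w Ww] WV WN]] := ndN _ oW.
  by exists (mul (inv x) v); rewrite /= mulA mulxV mul1.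
have phic : continuous (fun p : G * G => mul (inv p.1) p.2).
  move=> [p1 p2]; apply: (@continuous_comp _ _ _ (fun p : G * G => (inv p.1, p.2))
    (fun p : G * G => mul p.1 p.2)); last exact: mulc.
  apply: cvg_pair => /=; last exact: cvg_snd.
  by move=> C /invc Ci; exists (inv @^-1` C, setT); [split=> //; exact: filterT|move=> [a b] []].
have [|[A B] [/= xA xwB] AB] := phic (x, mul x w) W.
  by apply: open_nbhs_nbhs; split => //=; rewrite mulA mulV mul1.
exists (U `&` A^°), (V `&` B^°); split.
- by split; [apply: openI => //; exact: open_interior|exists x].
- by split; [apply: openI => //; exact: open_interior|exists (mul x w); split=> //; exact: WV].
- by move=> ? [].
- by move=> ? [].
- move=> a b [_ /interior_subset Aa] [_ /interior_subset Bb] Nab.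
  have : (W `&` N) (mul (inv a) b) by split => //; exact: (AB (a, b)).
  by rewrite WN.
Qed.

(** The ordered pairs of indices below [q] are treated one after another, shrinking two sets each
    time; this preserves what earlier pairs have achieved. Both orders of a pair occur since [N] may
    differ from [N^-1]. *)
Lemma separate (N : set G) (q : nat) (U : nat -> set G) :
  nowhere_dense_in open N -> (forall a, open (U a) /\ U a !=set0) ->
  exists V : nat -> set G, [/\ forall a, open (V a) /\ V a !=set0,
    forall a, V a `<=` U a &
    forall a b, (a < q)%N -> (b < q)%N -> a <> b ->
      forall x y, V a x -> V b y -> ~ N (mul (inv x) y)].
Proof.
move=> ndN oU.
suff sep_pairs : forall s : seq (nat * nat), exists V : nat -> set G,
    [/\ forall a, open (V a) /\ V a !=set0, forall a, V a `<=` U a &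
    forall p, p \in s -> p.1 <> p.2 ->
      forall x y, V p.1 x -> V p.2 y -> ~ N (mul (inv x) y)].
  have [V [oV VU VN]] := sep_pairs [seq (a, b) | a <- iota 0 q, b <- iota 0 q].
  exists V; split=> // a b aq bq ab x y; apply: (VN (a, b)) => //.
  by apply/allpairsP; exists (a, b); rewrite !mem_iota.
elim=> [|[a b] s [V [oV VU VN]]]; first by exists U; split=> // a.
have [ab|ab] := eqVneq a b.
  exists V; split=> // p; rewrite inE => /predU1P[->|].
    by rewrite ab.
  exact: VN.
have [[oVa Va0] [oVb Vb0]] := (oV a, oV b).
have [A [B [oA oB AV BV ABN]]] := separate2 ndN oVa Va0 oVb Vb0.
pose W c := if c == a then A else if c == b then B else V c.
have WV c : W c `<=` V c.
  by rewrite /W; case: eqP => [->//|_]; case: eqP => [->//|_ x].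
exists W; split=> [c|c|p].
- by rewrite /W; case: ifP => // _; case: ifP.
- exact: subset_trans (WV c) (VU c).
- rewrite inE => /predU1P[-> _ x y /=|ps p12 x y /WV Vx /WV Vy]; last exact: VN Vx Vy.
  by rewrite /W eqxx eq_sym (negbTE ab) eqxx; exact: ABN.
Qed.

End Separation.

(** * Spread measures and null translates *)

Section SeparatedCover.
Context (R : realType) (G : ptopologicalType) (mul : G -> G -> G) (inv : G -> G) (e : G).
Hypotheses (grp : is_group mul inv e).

Definition separated_family (N : set G) (q : nat) (V : nat -> set G) :=
  (forall a, open (V a)) /\
  forall a b, (a < q)%N -> (b < q)%N -> a <> b ->
    forall x y, V a x -> V b y -> ~ N (mul (inv x) y).

Definition others (q : nat) (V : nat -> set G) (a : nat) : set G :=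
  \bigcup_(b in [set b | (b < q)%N /\ b <> a]) V b.

(** With [q = 0] every measure would qualify. *)
Definition spread (N : set G) (eps : R) : set (PMeas G R) :=
  [set mu | exists q V, [/\ (0 < q)%N, separated_family N q V &
    forall a, (a < q)%N -> (mu (~` others q V a : set (Borel G)) <= eps%:E)%E]].

Lemma open_others q V a : (forall a, open (V a)) -> open (others q V a).
Proof. by move=> oV; apply: bigcup_open. Qed.

(* Fubini for the set of pairs with quotient in the union of the [N n], replaced by two
   applications of [covered_bigcup] so that neither [A] nor [N n] has to be measurable. *)
Lemma spread_T_l (N : nat -> set G) (A : set G) (mu : PMeas G R) :
  nondecreasing_seq N -> diffset mul inv A `<=` \bigcup_n N n ->
  (forall n, spread (N n) n.+1%:R^-1 mu) -> T_l mul A mu.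
Proof.
have [mulA mul1 _ mulV mulxV] := grp.
move=> ndN AN spr g; set B := ltrans mul g A.
(* Left translation cancels: [(ga)^-1 (gb) = a^-1 b]. *)
have BN x y : B x -> B y -> exists n, N n (mul (inv x) y).
  move=> [a Aa <-] [b Ab <-].
  have -> : mul (inv (mul g a)) (mul g b) = mul (inv a) b.
    suff -> : mul g b = mul (mul g a) (mul (inv a) b) by rewrite mulA mulV mul1.
    by rewrite -mulA (mulA a) mulxV mul1.
  by have [|n _ Nn] := AN (mul (inv a) b); [exists a, b|exists n].
apply: negligible_covered => eps eps0; apply: contrapT => Bncov.
pose section x m : set (Borel G) := [set y | B y /\ N m (mul (inv x) y)].
pose D m : set (Borel G) := [set x | B x /\ ~ covered mu eps%:E (section x m)].
have ndsec x : nondecreasing_seq (section x).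
  move=> m n mn; apply/subsetPset => y [By Ny]; split=> //.
  by move/subsetPset: (ndN _ _ mn); apply.
(* Otherwise the union of the [D m] is covered and thus misses a point [x] of [B]; all sections at
   [x] are then covered, and as they increase to [B], so is [B]. *)
have [m Dm] : exists m, ~ covered mu eps%:E (D m).
  apply/existsNP => Dcov; apply: (Bncov).
  apply: (@coveredS _ _ _ _ _ _ (\bigcup_m D m)).
    move=> x Bx; apply: contrapT => nDx; apply: Bncov.
    apply: coveredS (covered_bigcup (ndsec x) _) => [y By|k].
      by have [n Nn] := BN _ _ Bx By; exists n.
    by apply: contrapT => nc; apply: nDx; exists k.
  apply: covered_bigcup => [k l kl|k]; last exact: contrapT.
  apply/subsetPset => x [Bx nc]; split=> //; apply: contra_not nc.
  by apply: coveredS; apply/subsetPset; exact: ndsec.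
have [M _ /(_ M (leqnn M)) /= Meps] := near_infty_natSinv_lt (PosNum eps0).
have [q [V [q0 [oV sepV] Vsmall]]] := spr (maxn m M).
have small a : (a < q)%N -> covered mu eps%:E (~` others q V a : set (Borel G)).
  move=> aq; exists (~` others q V a); split=> //; last first.
    apply: le_trans (Vsmall a aq) _; rewrite lee_fin (le_trans _ (ltW Meps))//.
    by rewrite lef_pV2 ?posrE// ler_nat ltnS leq_maxr.
  by apply: measurableC; apply: measurable_open; exact: (@open_others q V a oV).
(* The index [0] is arbitrary. A point [x] of [D m] in some [V b] has its section disjoint from
   every other [V c], hence covered, against the definition of [D m]. So [D m] avoids
   [others q V 0]. *)
apply: Dm; apply: coveredS (small 0%N q0) => x [Bx nc] [b [bq _] Vbx].
apply: nc; apply: coveredS (small b bq) => y [By Ny] [c [cq cb] Vcy].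
apply: (sepV b c bq cq _ x y) => //; first by move=> bc; apply: cb.
by move/subsetPset: (ndN _ _ (leq_maxl m M)); apply.
Qed.

End SeparatedCover.

(** * Integrals of bounded measurable functions *)

Section BoundedMeasurable.
Context d (T : measurableType d) (R : realType).
Implicit Types (P : probability T R) (f g : T -> R).

Definition bounded_measurable f :=
  measurable_fun setT f /\ exists M : R, forall x, `|f x| <= M.

Lemma bounded_measurable_integrable P f :
  bounded_measurable f -> P.-integrable setT (EFin \o f).
Proof.
move=> [mf [M fM]]; apply: measurable_bounded_integrable => //.
  by rewrite (le_lt_trans (probability_le1 P measurableT))// ltry.
exists M; split; first exact: num_real.
move=> x Mx y _; apply: le_trans (fM y) (ltW Mx).
Qed.

Lemma EFin_Rintegral P f : bounded_measurable f ->
  (\int[P]_x (f x)%:E)%E = (\int[P]_x f x)%:E.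
Proof.
move=> bf; rewrite /Rintegral fineK//; apply: integrable_fin_num => //.
exact: bounded_measurable_integrable.
Qed.

Lemma bounded_measurable_cst c : bounded_measurable (cst c).
Proof. by split; [exact: measurable_cst|exists `|c|]. Qed.

Lemma bounded_measurableD f g : bounded_measurable f -> bounded_measurable g ->
  bounded_measurable (f \+ g).
Proof.
move=> [mf [M fM]] [mg [L gL]]; split; first exact: measurable_funD.
by exists (M + L) => x; apply: le_trans (ler_normD _ _) (lerD _ _).
Qed.

Lemma bounded_measurableN f : bounded_measurable f -> bounded_measurable (\- f).
Proof.
move=> [mf [M fM]]; split; first exact: measurableT_comp.
by exists M => x; rewrite normrN.
Qed.

Lemma probability_Rintegral_cst P c : \int[P]_x c = c.
Proof.
rewrite Rintegral_cst// -[RHS]mulr1; congr (_ * _).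
by have PT := congr1 fine (probability_setT P); exact: PT.
Qed.

Lemma Rintegral_dist P f g c : bounded_measurable f -> bounded_measurable g ->
  (forall x, `|f x - g x| <= c) -> `|\int[P]_x f x - \int[P]_x g x| <= c.
Proof.
move=> bf bg fg.
have bfg : bounded_measurable (fun x => f x - g x).
  exact: (bounded_measurableD bf (bounded_measurableN bg)).
rewrite -RintegralB//; try exact: bounded_measurable_integrable.
apply: le_trans (le_normr_Rintegral _ _) _ => //.
  exact: bounded_measurable_integrable.
rewrite -[leRHS](probability_Rintegral_cst P); apply: le_Rintegral => //.
  exact/integrable_norm/bounded_measurable_integrable.
exact/bounded_measurable_integrable/bounded_measurable_cst.
Qed.

End BoundedMeasurable.

(** * Averages of finitely many probability measures *)

Section Average.
Context d (T : measurableType d) (R : realType).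
Variables (m : nat -> probability T R) (N : nat).

Let weight : {nonneg R} := (N.+1%:R^-1)%:nng.

Definition average : set T -> \bar R := mscale weight (msum m N.+1).

HB.instance Definition _ := Measure.on average.

Let average_setT : average setT = 1%E.
Proof.
rewrite /average /mscale /= /msum.
rewrite (eq_bigr (fun=> 1%:E)) => [|i _]; last exact: probability_setT.
by rewrite sumEFin -EFinM sumr_const card_ord mulVf.
Qed.

HB.instance Definition _ := Measure_isProbability.Build _ _ _ average average_setT.

Let average_ge0 (f : T -> R) : bounded_measurable f -> (forall x, 0 <= f x) ->
  \int[average]_x f x = N.+1%:R^-1 * \sum_(l < N.+1) \int[m l]_x f x.
Proof.
move=> bf f0; apply: EFin_inj; rewrite -EFin_Rintegral// EFinM -sumEFin.
have mf : measurable_fun setT (EFin \o f) by apply/measurable_EFinP; case: bf.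
rewrite ge0_integral_mscale//=; last by move=> x _; rewrite lee_fin.
rewrite (@ge0_integral_measure_sum _ _ _ (fun k => m k))//; last first.
  by move=> x _; rewrite lee_fin.
by congr (_ * _)%E; apply: eq_bigr => l _; rewrite EFin_Rintegral.
Qed.

(** The formula for nonnegative functions is applied to [f + M], where [M] bounds [|f|]; the
    constant cancels because all the measures have mass one. *)
Lemma Rintegral_average (f : T -> R) : bounded_measurable f ->
  \int[average]_x f x = N.+1%:R^-1 * \sum_(l < N.+1) \int[m l]_x f x.
Proof.
move=> bf; have [M fM] := bf.2.
have bM : bounded_measurable (cst M : T -> R) by exact: bounded_measurable_cst.
have fME (P : probability T R) : \int[P]_x (f x + M) = \int[P]_x f x + M.
  by rewrite RintegralD ?probability_Rintegral_cst//; exact: bounded_measurable_integrable.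
have := average_ge0 (bounded_measurableD bf bM).
rewrite /= fME; under eq_bigr do rewrite fME.
rewrite big_split/= sumr_const card_ord mulrDr -[M *+ _]mulr_natl mulKf//.
move=> /(_ _)/addIr; apply => x.
by have := fM x; rewrite ler_norml => /andP[+ _]; rewrite -lerBlDr sub0r.
Qed.

End Average.

(** * Image measures and mass estimates *)

Section Transport.
Context (R : realType).

Lemma probability_pushforward d d' (T : measurableType d) (T' : measurableType d')
    (P : probability T R) (phi : T -> T') : measurable_fun setT phi ->
  exists Q : probability T' R,
    (forall B, Q B = P (phi @^-1` B)) /\
    forall h : T' -> R, bounded_measurable h -> \int[Q]_x h x = \int[P]_x h (phi x).
Proof.
move=> mphi.
pose mf := MeasurableFun.Pack (MeasurableFun.Class (isMeasurableFun.Build _ _ _ _ _ mphi)).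
exists (distribution P mf); split=> // h bh; rewrite /Rintegral integral_distribution//.
  by apply/measurable_EFinP; case: bh.
apply: (@bounded_measurable_integrable _ _ _ P (h \o phi)); have [mh [M hM]] := bh.
by split; [exact: measurableT_comp|exists M => x; exact: hM].
Qed.

(** [h] lies below the indicator of [W]. *)
Lemma Rintegral_le_probability d (T : measurableType d) (P : probability T R) (W : set T) (h : T -> R) :
  measurable W -> bounded_measurable h -> (forall x, 0 <= h x <= 1) ->
  (forall x, ~ W x -> h x = 0) -> ((\int[P]_x h x)%:E <= P W)%E.
Proof.
move=> mW bh h01 hW; rewrite -EFin_Rintegral// -[W]setIT -integral_indic//.
apply: ge0_le_integral => //.
- by move=> x _; rewrite lee_fin; have /andP[] := h01 x.
- by apply/measurable_EFinP; case: bh.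
- exact/measurable_EFinP/measurable_indic.
move=> x _; rewrite lee_fin indicE; have /andP[_ h1] := h01 x.
by case: (pselect (W x)) => Wx; [rewrite mem_set|rewrite memNset// hW].
Qed.

End Transport.

(** [op] is abstract so as to serve both the topology of [G] and [weak_open]. *)
Lemma finite_intersection_closed (T : Type) (op : set (set T)) (q : nat) (U : nat -> set T) :
  op setT -> (forall A B, op A -> op B -> op (A `&` B)) ->
  (forall a, (a < q)%N -> op (U a)) -> op [set x | forall a, (a < q)%N -> U a x].
Proof.
move=> opT opI; elim: q => [|q IH] oU.
  by rewrite (_ : mkset _ = setT)//; apply/seteqP; split.
rewrite (_ : mkset _ = [set x | forall a, (a < q)%N -> U a x] `&` U q).
  by apply: opI; [apply: IH => a aq; apply: oU; exact: ltnW|exact: oU].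
apply/seteqP; split=> [x H|x [H Uq] a].
  by split=> [a aq|]; apply: H => //; exact: ltnW.
by rewrite ltnS leq_eqVlt => /predU1P[->//|]; exact: H.
Qed.

(** * Weak* open sets of measures *)

Section WeakOpen.
Context (R : realType) (G : ptopologicalType).

Lemma bounded_continuous_measurable (f : G -> R) :
  bounded_continuous f -> bounded_measurable (f : Borel G -> R).
Proof.
move=> [cf bf]; split=> //.
apply: (measurability _ (RGenOpens.measurableE R)) => _ [_ [a [b ->] <-]].
rewrite setTI; apply: measurable_open; apply: open_comp => // x _; exact: cf.
Qed.

Lemma weak_openT : weak_open (setT : set (PMeas G R)).
Proof. by move=> mu _; exists 0%N, (fun _ _ => 0), 1; split. Qed.

Lemma weak_openI (U V : set (PMeas G R)) :
  weak_open U -> weak_open V -> weak_open (U `&` V).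
Proof.
move=> oU oV mu [Umu Vmu].
have [n [f [eps [eps0 bf fU]]]] := oU mu Umu.
have [m [g [del [del0 bg gV]]]] := oV mu Vmu.
exists (n + m)%N, (fun i => if (i < n)%N then f i else g (i - n)%N), (Num.min eps del).
split; first by rewrite lt_min eps0.
  by move=> i inm; case: ifP => [/bf//|/negbT]; rewrite -leqNgt => ni; apply: bg; rewrite ltn_subLR.
move=> nu /= Hnu; split.
  apply: fU => i ltin /=; have := Hnu i (ltn_addr _ ltin); rewrite ltin => /lt_le_trans; apply.
  by rewrite lee_fin ge_min lexx.
apply: gV => i ltim /=; have := Hnu (n + i)%N; rewrite ltn_add2l => /(_ ltim).
rewrite ltnNge leq_addr/= addKn => /lt_le_trans; apply.
by rewrite lee_fin ge_min lexx orbT.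
Qed.

Lemma weak_open_gt (h : G -> R) c : bounded_continuous h ->
  weak_open [set mu : PMeas G R | c < \int[mu]_x h x].
Proof.
move=> bh mu /= cmu.
have bm := bounded_continuous_measurable bh.
exists 1%N, (fun=> h), (\int[mu]_x h x - c); split; rewrite ?subr_gt0// => nu /= /(_ 0%N isT).
rewrite !EFin_Rintegral// lte_fin ltr_norml => /andP[+ _].
by rewrite opprB ltrBrDl subrKC.
Qed.

End WeakOpen.

(** * Continuous bump functions *)

Section Bump.
Context (R : realType) (G : ptopologicalType) (d : G -> G -> R).
Hypotheses (dmet : is_metric d) (dcomp : metric_compatible d).

Lemma point_bump (W : set G) x : open W -> W x ->
  exists h : G -> R, [/\ continuous h, forall y, 0 <= h y <= 1, h x = 1 &
    forall y, ~ W y -> h y = 0].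
Proof.
have [dge d0 dC dT] := dmet.
move=> oW Wx; have [r r0 rW] := (dcomp W).1 oW x Wx.
exists (fun y => Num.max 0 (1 - d x y / r)); split.
- move=> y; apply: (@continuous_max _ _ (cst 0) (fun y => 1 - d x y / r)) => z; first exact: cvg_cst.
  apply: cvgB; first exact: cvg_cst.
  by apply: cvgM; [exact: continuous_mdist|exact: cvg_cst].
- move=> y; rewrite le_max lexx /= ge_max ler01 /= gerBl.
  by rewrite divr_ge0// ltW.
- by rewrite (d0 x x).2// mul0r subr0 max_r.
- move=> y Wy; apply/max_l; rewrite subr_le0 ler_pdivlMr// mul1r leNgt.
  by apply/negP => /rW.
Qed.

(** The maximum of bumps at the single points. Finitely many points suffice because the measures
    built for the density argument have finite support. *)
Lemma finite_bump (W : set G) (s : seq G) : open W -> (forall x, x \in s -> W x) ->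
  exists h : G -> R, [/\ continuous h, forall y, 0 <= h y <= 1,
    forall x, x \in s -> h x = 1 & forall y, ~ W y -> h y = 0].
Proof.
move=> oW; elim: s => [|x s IH] sW.
  exists (cst 0); split=> //; first by move=> y; exact: cvg_cst.
  by move=> y; rewrite lexx ler01.
have [|h [ch h01 hs hW]] := IH; first by move=> y ys; apply: sW; rewrite inE ys orbT.
have [|g [cg g01 gx gW]] := @point_bump W x oW; first by apply: sW; rewrite mem_head.
exists (fun y => Num.max (g y) (h y)); split.
- by move=> y; apply: continuous_max; [exact: cg|exact: ch].
- move=> y; rewrite le_max ge_max.
  by have /andP[-> ->] := g01 y; have /andP[_ ->] := h01 y.
- move=> y; rewrite inE => /predU1P[->|/hs ->].
    by rewrite gx max_l//; have /andP[] := h01 x.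
  by rewrite max_r//; have /andP[] := g01 y.
- by move=> y Wy; rewrite gW// hW// maxxx.
Qed.

End Bump.

(** * Finite measurable partitions with small oscillation *)

Section FiniteCode.
Context (R : realType) (G : ptopologicalType).

(** The values of [f], shifted by the bound [M] to be nonnegative, are sorted into half-open
    intervals of length [eta]; [k] records the interval. *)
Lemma finite_code1 (f : G -> R) (eta : R) : bounded_continuous f -> 0 < eta ->
  exists (q : nat) (k : G -> 'I_q.+1),
    (forall c, measurable (k @^-1` [set c] : set (Borel G))) /\
    forall x y, k x = k y -> `|f x - f y| < eta.
Proof.
move=> bf eta0; have [mf _] := bounded_continuous_measurable bf.
have [_ [M fM]] := bf.
pose g x : R := (f x + M) / eta.
have mg : measurable_fun setT (g : Borel G -> R).
  by apply: measurable_funM => //; exact: measurable_funD.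
have fM2 x : 0 <= f x + M <= M + M.
  by have := fM x; rewrite ler_norml -lerBlDr sub0r lerD2r.
have g0 x : 0 <= g x by rewrite divr_ge0 ?(ltW eta0)//; have /andP[] := fM2 x.
pose q := Num.truncn ((M + M) / eta).
have gq x : (Num.truncn (g x) < q.+1)%N.
  by rewrite ltnS le_truncn// ler_pM2r ?invr_gt0//; have /andP[] := fM2 x.
exists q, (fun x => Ordinal (gq x)); split=> [c|x y /(congr1 val) /= gxy].
  rewrite (_ : _ @^-1` _ = g @^-1` [set` `[c%:R, c.+1%:R[ ]).
    by rewrite -[X in measurable X]setTI; exact: mg.
  apply/seteqP; split => x /=; rewrite in_itv/= -truncn_eq//; first by move=> <-.
  by move=> /eqP xc; exact/val_inj.
have := truncn_itv (g0 x); have := truncn_itv (g0 y); rewrite gxy => /andP[ly uy] /andP[lx ux].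
have : `|g x - g y| < 1.
  by rewrite ltr_norml; apply/andP; split; move: ly uy lx ux; rewrite -natr1; lra.
by rewrite -mulrBl opprD addrACA subrr addr0 normrM normfV (gtr0_norm eta0) ltr_pdivrMr// mul1r.
Qed.

Lemma finite_code (n : nat) (f : nat -> G -> R) (eta : R) :
  (forall i, (i < n)%N -> bounded_continuous (f i)) -> 0 < eta ->
  exists (T : finType) (k : G -> T),
    (forall c, measurable (k @^-1` [set c] : set (Borel G))) /\
    forall x y, k x = k y -> forall i, (i < n)%N -> `|f i x - f i y| < eta.
Proof.
move=> + eta0; elim: n => [_|n IH bf].
  exists unit, (fun=> tt); split=> // -[].
  by rewrite (_ : _ @^-1` _ = setT)//; apply/seteqP; split.
have [|T [k [mk kP]]] := IH; first by move=> i ltin; apply: bf; exact: ltnW.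
have [q [l [ml lP]]] := finite_code1 (bf n (leqnn _)) eta0.
exists (T * 'I_q.+1)%type, (fun x => (k x, l x)); split=> [[c1 c2]|x y [kxy lxy] i].
  rewrite (_ : _ @^-1` _ = (k @^-1` [set c1]) `&` (l @^-1` [set c2])).
    exact: measurableI.
  by apply/seteqP; split=> x /= [-> ->].
by rewrite ltnS leq_eqVlt => /predU1P[->|]; [exact: lP|exact: kP].
Qed.

Lemma finite_range_measurable (T : finType) (k : G -> T) (p : T -> G) :
  (forall c, measurable (k @^-1` [set c] : set (Borel G))) ->
  measurable_fun setT (p \o k : Borel G -> Borel G).
Proof.
move=> mk _ B _; rewrite setTI.
rewrite (_ : _ @^-1` _ = \bigcup_(c in [set c | B (p c)]) (k @^-1` [set c])).
  by apply: fin_bigcup_measurable => //; exact: finite_finset.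
by apply/seteqP; split=> [x Bx|x [c Bc /= ->//]]; exists (k x).
Qed.

End FiniteCode.

Lemma mean_dist (R : realFieldType) (N : nat) (a : 'I_N.+1 -> R) b c :
  (forall l, `|a l - b| <= c) -> `|N.+1%:R^-1 * (\sum_(l < N.+1) a l) - b| <= c.
Proof.
move=> abc.
have -> : N.+1%:R^-1 * (\sum_(l < N.+1) a l) - b =
    N.+1%:R^-1 * \sum_(l < N.+1) (a l - b).
  by rewrite sumrB sumr_const card_ord mulrBr -[b *+ _]mulr_natl mulKf.
rewrite normrM ger0_norm// mulrC ler_pdivrMr//.
apply: le_trans (ler_norm_sum _ _ _) _.
apply: le_trans (ler_sum _ (fun l _ => abc l)) _.
by rewrite sumr_const card_ord mulr_natr.
Qed.

Lemma mean_all_but_one (R : realFieldType) (N : nat) (a : 'I_N.+1 -> R) (r : 'I_N.+1) :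
  (forall l, 0 <= a l) -> (forall l, l != r -> a l = 1) ->
  1 - N.+1%:R^-1 <= N.+1%:R^-1 * \sum_(l < N.+1) a l.
Proof.
move=> a0 a1; rewrite (bigD1 r)//= (eq_bigr (fun=> 1)) // sumr_const.
have -> : #|[pred l | l != r]| = N by have := cardC1 r; rewrite card_ord /= => ->.
have -> : 1 - N.+1%:R^-1 = N.+1%:R^-1 * N%:R :> R.
  by apply: (@mulfI _ N.+1%:R) => //; rewrite mulrBr mulr1 mulfV// mulVKf// -natr1 addrK.
by rewrite ler_pM2l// lerDr.
Qed.

(** * Density of the spread measures *)

Section SpreadDense.
Context (R : realType) (G : ptopologicalType) (d : G -> G -> R)
  (mul : G -> G -> G) (inv : G -> G) (e : G).
Hypotheses (dmet : is_metric d) (dcomp : metric_compatible d)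
  (grp : is_group mul inv e)
  (mulc : continuous (fun p : G * G => mul p.1 p.2)) (invc : continuous inv).

(** Since [h a] lies below the indicator of [others q V a], lower bounds on its integrals force
    spreading; unlike the masses themselves, these integrals depend continuously on the measure. *)
Lemma bump_spread (N : set G) (eps : R) (q : nat) (V : nat -> set G) (h : nat -> G -> R)
    (rho : PMeas G R) :
  (0 < q)%N -> separated_family mul inv N q V ->
  (forall a, [/\ bounded_continuous (h a), forall y, 0 <= h a y <= 1 &
    forall y, ~ others q V a y -> h a y = 0]) ->
  (forall a, (a < q)%N -> 1 - eps < \int[rho]_x h a x) -> spread mul inv N eps rho.
Proof.
move=> q0 sepV hP rho_h; exists q, V; split=> // a aq.
have [bh h01 h0] := hP a; have [oV _] := sepV.
have mW : measurable (others q V a : set (Borel G)).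
  by apply: measurable_open; exact: (@open_others _ q V a oV).
rewrite probability_setC// leeBlDr ?fin_num_measure//.
have := Rintegral_le_probability rho mW (bounded_continuous_measurable bh) h01 h0.
move=> /(leeD2l eps%:E); apply: le_trans.
by rewrite -EFinD lee_fin -lerBlDl ltW// rho_h.
Qed.

(** Each cell shares its mass equally among [M+1] targets, so a single index receives at most
    [1/(M+1) < eps] of the total, however [mu] is distributed. The bumps [h a] then extend this to a
    weak* neighbourhood. *)
Lemma nowhere_dense_not_spread (N : set G) (eps : R) : nowhere_dense_in open N -> 0 < eps ->
  nowhere_dense_in (@weak_open R G) (~` spread mul inv N eps).
Proof.
move=> ndN eps0 U oU [mu Umu].
have [n [f [del [del0 bf fU]]]] := oU mu Umu.
have del4 : 0 < del / 4 by rewrite divr_gt0.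
have [T [k [mk kP]]] := finite_code bf del4.
(* [p c] lies in the cell of [c]; for an empty cell it is the default [point]. *)
have /choice[p kp] : forall c : T, exists p, forall x, k x = c -> k p = c.
  by move=> c; have [[x kx]|nx] := pselect (exists x, k x = c);
    [exists x|exists point => x kx; case: nx; exists x].
have [M _ /(_ M (leqnn M)) /= Meps] := near_infty_natSinv_lt (PosNum eps0).
(* The targets of cell [c] have the indices [idx c l] with [l <= M], and [cell] recovers [c] by
   division. Beyond [q] it defaults to [k point], as [separate] wants a set for every natural
   number. *)
pose cell a : T := nth (k point) (enum T) (a %/ M.+1).
pose idx (c : T) (l : nat) := (enum_rank c * M.+1 + l)%N.
pose q := (#|T| * M.+1)%N.
have q0 : (0 < q)%N by rewrite muln_gt0/= andbT; apply/card_gt0P; exists (k point).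
have idxq c l : (l < M.+1)%N -> (idx c l < q)%N.
  move=> lM; apply: (@leq_trans ((enum_rank c).+1 * M.+1)%N).
    by rewrite /idx mulSn addnC ltn_add2r.
  by rewrite leq_pmul2r.
have cell_idx c l : (l < M.+1)%N -> cell (idx c l) = c.
  by move=> lM; rewrite /cell /idx divnMDl// divn_small// addn0 nth_enum_rank.
(* Only the values of the [f i] must be close: a target may leave its cell, which can have empty
   interior. *)
have [|V [oV VU VN]] := separate grp mulc invc q
    (U := fun a => [set x | forall i, (i < n)%N -> `|f i (p (cell a)) - f i x| < del / 4]) ndN.
  move=> a; split; last by exists (p (cell a)) => i _ /=; rewrite subrr normr0.
  apply: finite_intersection_closed; [exact: openT|exact: openI|move=> i ltin].
  apply: (@open_comp _ _ (fun x => `|f i (p (cell a)) - f i x|) [set t | t < del / 4]); last exact: open_lt.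
  move=> x _; apply: cvg_norm; apply: cvgB; first exact: cvg_cst.
  by have [cf _] := bf i ltin; exact: cf.
have /choice[x Vx] : forall a, exists x, V a x by move=> a; have [_ []] := oV a; eauto.
pose psi l := (fun c => x (idx c l)) \o k.
(* One [del / 4] is the oscillation on a cell, the other the deviation of a target from [p (k y)];
   the total [del / 2] leaves room for the strict inequality. *)
have psif i l y : (i < n)%N -> (l < M.+1)%N -> `|f i (psi l y) - f i y| <= del / 2.
  move=> ltin lM; have := VU _ _ (Vx (idx (k y) l)) i ltin; rewrite cell_idx// => H1.
  have H2 := kP _ _ (kp _ y erefl) i ltin.
  rewrite (le_trans (ler_distD (f i (p (k y))) _ _))// [X in X + _]distrC.
  by move: H1 H2 del0; rewrite /psi /=; lra.
have /choice[m mP] : forall l, exists Q : PMeas G R,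
    forall h : Borel G -> R, bounded_measurable h -> \int[Q]_y h y = \int[mu]_y h (psi l y).
  move=> l; have [Q [_ HQ]] := probability_pushforward mu
    (finite_range_measurable (fun c => x (idx c l)) mk).
  by exists Q.
have /choice[h hP] : forall a, exists h : G -> R, [/\ continuous h, forall y, 0 <= h y <= 1,
    forall y, y \in [seq x b | b <- iota 0 q & b != a] -> h y = 1 &
    forall y, ~ others q V a y -> h y = 0].
  move=> a; apply: (finite_bump dmet dcomp).
    by apply: open_others => b; have [] := oV b.
  move=> y /mapP[b]; rewrite mem_filter mem_iota => /andP[ba /= bq] ->.
  by exists b => //; split=> //; exact/eqP.
have bh a : bounded_continuous (h a).
  have [ch h01 _ _] := hP a; split=> //; exists 1 => y.
  by have /andP[hy0 hy1] := h01 y; rewrite ger0_norm.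
pose V' := U `&` [set rho : PMeas G R | forall a, (a < q)%N -> 1 - eps < \int[rho]_y h a y].
exists V'; split.
- apply: weak_openI => //; apply: finite_intersection_closed.
  + exact: weak_openT.
  + exact: weak_openI.
  + by move=> a _; exact: weak_open_gt.
- exists (average m M); split.
    apply: fU => i ltin /=.
    have bfi := bounded_continuous_measurable (bf i ltin).
    rewrite !EFin_Rintegral// -EFinB abse_EFin lte_fin.
    apply: (@le_lt_trans _ _ (del / 2)); last by move: del0; lra.
    rewrite Rintegral_average//; apply: mean_dist => l; rewrite mP//.
    apply: Rintegral_dist => //; last by move=> y; apply: psif.
    have [mf [C fC]] := bfi; split; last by exists C => y; exact: fC.
    exact: (measurableT_comp mf (finite_range_measurable (fun c => x (idx c l)) mk)).
  move=> a aq /=; have bha := bounded_continuous_measurable (bh a).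
  have [_ h01 h1 _] := hP a.
  rewrite Rintegral_average//; apply: (@lt_le_trans _ _ (1 - M.+1%:R^-1)); first by rewrite ltrD2l ltrN2.
  (* Index [a] has the form [idx c l] only for [l = a mod (M+1)]; for every other [l] the values of
     [psi l] are targets at which [h a] is 1. *)
  apply: (@mean_all_but_one _ _ _ (inord (a %% M.+1))) => l.
    by apply: Rintegral_ge0 => y _; have /andP[] := h01 y.
  move=> la; rewrite mP// -[RHS](probability_Rintegral_cst mu); apply: eq_Rintegral => y _.
  apply: h1; apply: map_f; rewrite mem_filter mem_iota/= idxq// andbT.
  apply: contra la => /eqP <-; rewrite /idx modnMDl modn_small//; apply/eqP/val_inj.
  by rewrite /= inordK.
- by move=> rho [].
- apply/seteqP; split=> // rho [[_ rho_h]]; apply.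
  apply: (bump_spread (V := V) (h := h) q0) => //; first by split=> // a; have [] := oV a.
  by move=> a; have [] := hP a.
Qed.

End SpreadDense.

(** * Dyadic intervals and the uniform measure *)

Section DyadicIndex.
Context (R : realType).

(** The number of the dyadic interval of length [2^-n] containing [t]; negative [t] get the value
    0. *)
Definition dyadic (n : nat) (t : R) : nat := Num.truncn (2 ^+ n * t).

Lemma dyadic_lt0 n t : t < 0 -> dyadic n t = 0%N.
Proof.
move=> t0; apply/truncn0Pn; rewrite -ltNge; apply: lt_trans ltr01.
by rewrite pmulr_rlt0// exprn_gt0.
Qed.

(** Halving the index passes to the parent interval; the Cantor scheme uses the same numbering. *)
Lemma dyadic_half n t : ((dyadic n.+1 t)./2 = dyadic n t)%N.
Proof.
have [t0|t0] := ltP t 0; first by rewrite !dyadic_lt0.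
rewrite /dyadic; apply/esym/truncn_def; set m := Num.truncn _.
have : m%:R <= 2 ^+ n.+1 * t < m.+1%:R by apply: truncn_itv; rewrite mulr_ge0.
have eS k : k.+1%:R = k%:R + 1 :> R by rewrite natr1.
have mE : m%:R = (odd m)%:R + 2 * (m./2)%:R :> R.
  by rewrite -[in LHS](odd_double_half m) natrD -mul2n natrM.
by rewrite exprS -mulrA !eS mE; case: (odd m) => /=; lra.
Qed.

Lemma dyadic_bound n t k : 0 <= t -> dyadic n t = k ->
  k%:R / 2 ^+ n <= t <= k.+1%:R / 2 ^+ n.
Proof.
move=> t0 /eqP; rewrite /dyadic truncn_eq ?mulr_ge0// => /andP[lk uk].
by rewrite ler_pdivrMr ?ler_pdivlMr ?exprn_gt0// mulrC lk ltW// mulrC.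
Qed.

Lemma dyadic_lt n t : t < 1 -> (dyadic n t < 2 ^ n)%N.
Proof.
move=> t1; have [t0|t0] := ltP t 0; first by rewrite dyadic_lt0// expn_gt0.
by rewrite /dyadic truncn_lt_nat ?mulr_ge0// natrX gtr_pMr// exprn_gt0.
Qed.

Lemma measurable_dyadic n (K : set nat) :
  measurable (dyadic n @^-1` K : set (measurableTypeR R)).
Proof.
have mlt k : measurable ([set t | (k < dyadic n t)%N] : set (measurableTypeR R)).
  rewrite (_ : [set t | _] = (fun t => 2 ^+ n * t) @^-1` `[k.+1%:R, +oo[).
    rewrite -[X in measurable X]setTI.
    by apply: (@mulrl_measurable R setT (2 ^+ n)) => //; exact: measurable_itv.
  by apply/seteqP; split=> t /=; rewrite in_itv/= andbT /dyadic truncn_gt_nat.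
have meq k : measurable ([set t | dyadic n t = k] : set (measurableTypeR R)).
  case: k => [|k].
    rewrite (_ : [set t | _] = ~` [set t | (0 < dyadic n t)%N]); first exact: measurableC.
    by apply/seteqP; split=> t /= => [->//|/negP]; rewrite -eqn0Ngt => /eqP.
  rewrite (_ : [set t | _] = [set t | (k < dyadic n t)%N] `\` [set t | (k.+1 < dyadic n t)%N]).
    exact: measurableD.
  apply/seteqP; split=> t /= => [->|[kt /negP]]; first by rewrite ltnn ltnS leqnn.
  by rewrite -leqNgt => tk; apply/eqP; rewrite eqn_leq tk.
rewrite (_ : _ @^-1` K = \bigcup_(k in K) [set t | dyadic n t = k]).
  exact: bigcup_measurable.
by apply/seteqP; split=> [t Kt|t [k Kk /= ->//]]; exists (dyadic n t).
Qed.

Lemma uniform_prob01E (E : set (measurableTypeR R)) : measurable E ->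
  uniform_prob (@ltr01 R) E = lebesgue_measure (E `&` `[0, 1]).
Proof.
move=> mE; rewrite /uniform_prob integral_uniform_pdf.
have mE01 : measurable (E `&` `[0, 1] : set (measurableTypeR R)) by exact: measurableI.
rewrite (eq_integral (fun=> 1%:E)) ?integral_cst ?mul1e// => t.
by rewrite inE => -[_ /=]; rewrite in_itv/= /uniform_pdf => ->; rewrite subr0 invr1.
Qed.

Lemma uniform_prob01_dyadic n a (E : set (measurableTypeR R)) : measurable E ->
  (forall t, 0 <= t < 1 -> E t -> dyadic n t = a) ->
  (uniform_prob (@ltr01 R) E <= (2 ^- n)%:E)%E.
Proof.
move=> mE Ea; rewrite uniform_prob01E//.
pose I : set (measurableTypeR R) := `[a%:R / 2 ^+ n, a.+1%:R / 2 ^+ n]%classic.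
(* The end point 1 has index [2^n] and escapes [Ea], so it is added as a null set. *)
pose one : set (measurableTypeR R) := [set 1].
have mI : measurable I by exact: measurable_itv.
have mone : measurable one by exact: measurable_set1.
have muI : lebesgue_measure I = (2 ^- n)%:E.
  rewrite /I lebesgue_measure_itv/= lte_fin.
  rewrite ltr_pM2r ?invr_gt0 ?exprn_gt0// ltr_nat leqnn -EFinB.
  by rewrite -mulrBl -natr1 addrAC subrr add0r mul1r.
apply: (@le_trans _ _ (lebesgue_measure (I `|` one))).
  apply: le_measure; rewrite ?inE; [exact: measurableI|exact: measurableU|].
  move=> t [Et]; rewrite /= in_itv/= => /andP[t0]; rewrite le_eqVlt => /predU1P[->|t1]; [by right|left].
  by rewrite /I /= in_itv/=; apply: dyadic_bound => //; apply: Ea; rewrite ?t0.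
apply: le_trans (measureU2 _ _ _) _ => //.
rewrite [leLHS](_ : _ = (2 ^- n)%:E)// -[RHS]adde0.
by congr (_ + _)%E; [exact: muI|exact: lebesgue_measure_set1].
Qed.

End DyadicIndex.

(** * A Cantor scheme and a measure spread at all scales *)

Section CantorScheme.
Context (R : realType) (G : ptopologicalType) (d : G -> G -> R)
  (mul : G -> G -> G) (inv : G -> G) (e : G).
Hypotheses (dmet : is_metric d) (dcomp : metric_compatible d) (dcomplete : metric_complete d)
  (grp : is_group mul inv e)
  (mulc : continuous (fun p : G * G => mul p.1 p.2)) (invc : continuous inv).

(** In the radius of the ball, [r / 2] keeps the closure inside [U] and [eps / 2] bounds distances
    within [V]. *)
Lemma shrink (U : set G) x eps : open U -> U x -> 0 < eps ->
  exists V, [/\ open V, V x, closure V `<=` U & forall y z, V y -> V z -> d y z < eps].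
Proof.
have [dge d0 dC dT] := dmet.
move=> oU Ux eps0; have [r r0 rU] := (dcomp U).1 oU x Ux.
have s0 : 0 < Num.min (r / 2) (eps / 2) by rewrite lt_min !divr_gt0.
exists [set y | d x y < Num.min (r / 2) (eps / 2)]; split.
- exact: open_mball.
- by rewrite /= (d0 x x).2.
- move=> y /(_ [set z | d y z < r / 2])[|z [/=]].
    by apply: nbhs_mball => //; rewrite divr_gt0.
  rewrite lt_min => /andP[xz _] yz; apply: rU => /=.
  by apply: le_lt_trans (dT x z y) _; rewrite (dC z y); move: xz yz; lra.
- move=> y z /=; rewrite !lt_min => /andP[_ xy] /andP[_ xz].
  by apply: le_lt_trans (dT y x z) _; rewrite (dC y x); move: xy xz; lra.
Qed.

(** Both children [2k] and [2k+1] start from the same set [V k]; [separate] pulls them apart, and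
    shrinking afterwards keeps them so. *)
Lemma scheme_step (N : set G) (q : nat) (eps : R) (V : nat -> set G) :
  nowhere_dense_in open N -> 0 < eps -> (forall k, open (V k) /\ V k !=set0) ->
  exists V', [/\ forall k, open (V' k) /\ V' k !=set0, forall k, closure (V' k) `<=` V k./2,
    forall k y z, V' k y -> V' k z -> d y z < eps & separated_family mul inv N q V'].
Proof.
move=> ndN eps0 oV.
have [|W [oW WV WN]] := separate grp mulc invc q (U := fun k => V k./2) ndN; first by move=> k; exact: oV.
have /choice[V' HV'] : forall k, exists V', [/\ open V', V' !=set0, closure V' `<=` W k &
    forall y z, V' y -> V' z -> d y z < eps].
  move=> k; have [oWk [x Wx]] := oW k; have [V' [? ? ? ?]] := shrink oWk Wx eps0.
  by exists V'; split=> //; exists x.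
have V'W k : V' k `<=` W k.
  by have [_ _ VW _] := HV' k; apply: subset_trans VW; exact: subset_closure.
exists V'; split=> [k|k|k|].
- by have [] := HV' k.
- by have [_ _ VW _] := HV' k; apply: subset_trans (WV k).
- by have [] := HV' k.
- split=> [k|a b aq bq ab x y /V'W Wx /V'W Wy]; first by have [] := HV' k.
  exact: WN Wx Wy.
Qed.

(** [phi] follows the dyadic intervals of [t] through the scheme, and [mu] is the image of the
    uniform measure. At level [n+1], only parameters of index [a] can land outside [others], and in
    [[0, 1]] they have measure at most [2^-(n+1) <= 1/(n+1)]. *)
Lemma spread_nonempty (N : nat -> set G) :
  (forall n, nowhere_dense_in open (N n)) ->
  exists mu : PMeas G R, forall n, spread mul inv (N n) n.+1%:R^-1 mu.
Proof.
move=> ndN; have [dge d0 dC dT] := dmet.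
pose good (V : nat -> set G) := forall k, open (V k) /\ V k !=set0.
have /choice[F HF] : forall p : nat * (nat -> set G), exists V', good p.2 ->
    [/\ good V', forall k, closure (V' k) `<=` p.2 k./2,
    forall k y z, V' k y -> V' k z -> d y z < p.1.+1%:R^-1 &
    separated_family mul inv (N p.1) (2 ^ p.1.+1) V'].
  move=> [n V]; have [gV|] := pselect (good V); last by exists V.
  have n0 : 0 < n.+1%:R^-1 :> R by rewrite invr_gt0.
  by have [V' ?] := scheme_step (2 ^ n.+1) (ndN n) n0 gV; exists V'.
(* Level 0 has the whole space at every node; level [n+1] takes care of [N n]. *)
pose fix W n := if n is m.+1 then F (m, W m) else (fun=> setT).
have gW n : good (W n).
  elim: n => [k|n IH]; first by split; [exact: openT|exists point].
  by have [] := HF (n, W n) IH.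
have clW n k : closure (W n.+1 k) `<=` W n k./2 by have [_ + _ _] := HF (n, W n) (gW n); apply.
have diamW n k y z : W n.+1 k y -> W n.+1 k z -> d y z < n.+1%:R^-1.
  by have [_ _ + _] := HF (n, W n) (gW n); apply.
have sepW n : separated_family mul inv (N n) (2 ^ n.+1) (W n.+1) by have [] := HF (n, W n) (gW n).
have Wdec (t : R) n m : (n <= m)%N -> W m (dyadic m t) `<=` W n (dyadic n t).
  elim: m => [|m IH]; first by rewrite leqn0 => /eqP->.
  rewrite leq_eqVlt => /predU1P[->//|nm]; apply: subset_trans (IH nm).
  by rewrite -(dyadic_half m t); apply: subset_trans (@clW m _); exact: subset_closure.
have /choice[phi Hphi] : forall t : R, exists x, forall n, W n (dyadic n t) x.
  move=> t; have /choice[c Hc] : forall n, exists c, W n (dyadic n t) c by move=> n; have [] := gW n (dyadic n t).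
  (* The points [c n] form a Cauchy sequence by [diamW]; the limit lies in the closures, hence by
     [clW] in the sets themselves. *)
  have [eps eps0|l cl] := dcomplete (u := c).
    have [M _ /(_ M (leqnn M)) /= Meps] := near_infty_natSinv_lt (PosNum eps0).
    exists M.+1 => m n Mm Mn; apply: lt_trans Meps.
    by apply: (@diamW M (dyadic M.+1 t)); [exact: (Wdec t _ _ Mm _ (Hc m))|exact: (Wdec t _ _ Mn _ (Hc n))].
  exists l => n; rewrite -dyadic_half; apply: clW => B /cl[m _ mB].
  exists (c (maxn m n.+1)); split; last by apply: mB; exact: leq_maxl.
  by apply: (Wdec t n.+1 _ (leq_maxr m _)); exact: Hc.
have mphi : measurable_fun setT (phi : measurableTypeR R -> Borel G).
  apply: (@measurability _ _ (measurableTypeR R) (Borel G) setT phi (@open G)) => //.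
  move=> _ [U oU <-]; rewrite setTI.
  (* Diameters tend to zero, so an open set around [phi t] contains some [W n (dyadic n t)], a
     condition on a single dyadic index. *)
  rewrite (_ : _ @^-1` U = \bigcup_n (dyadic n @^-1` [set k | W n k `<=` U])).
    by apply: bigcupT_measurable => n; exact: measurable_dyadic.
  apply/seteqP; split=> t /= => [Ut|[n _ WU]]; last by apply: WU; exact: Hphi.
  have [r r0 rU] := (dcomp U).1 oU _ Ut.
  have [M _ /(_ M (leqnn M)) /= Mr] := near_infty_natSinv_lt (PosNum r0).
  exists M.+1 => // y Wy; apply: rU => /=; apply: lt_trans Mr.
  exact: (@diamW M (dyadic M.+1 t)).
have [mu [muE _]] := probability_pushforward (uniform_prob (@ltr01 R)) mphi.
exists mu => n; exists (2 ^ n.+1)%N, (W n.+1); split=> //; first by rewrite expn_gt0.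
move=> a aq; rewrite muE.
have mO : measurable (~` others (2 ^ n.+1) (W n.+1) a : set (Borel G)).
  by apply: measurableC; apply: measurable_open; apply: open_others => b; have [] := gW n.+1 b.
apply: (@le_trans _ _ (2 ^- n.+1)%:E); last first.
  by rewrite lee_fin lef_pV2 ?posrE ?exprn_gt0// -natrX ler_nat ltnW// ltn_expl.
apply: (@uniform_prob01_dyadic _ _ a).
  by rewrite -[X in measurable X]setTI; exact: mphi.
move=> t /andP[t0 t1]; apply: contra_notP => ta.
by exists (dyadic n.+1 t) => //; split=> //; exact: dyadic_lt.
Qed.

End CantorScheme.

(** * Comeagerness of [T_l] and its consequences for analytic sets *)

Unset Implicit Arguments.

Theorem theoremA (R : realType) (G : ptopologicalType)
    (mul : G -> G -> G) (inv : G -> G) (e : G) :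
  polish_group R mul inv e ->
  ~ countable [set: G] ->
  [/\ (forall A : set G, univ_measurable R A ->
         meager_in open (diffset mul inv A) ->
         comeager_in (@weak_open R G) (@T_l R G mul A)),
      (forall A : set G, analytic A ->
         ~ gen_left_haar_null R mul A ->
         ~ meager_in open (diffset mul inv A)) &
      (forall A : set G, analytic A ->
         ~ left_haar_null R mul A ->
         ~ meager_in open (diffset mul inv A))].
Proof.
move=> [grp mulc invc [_ [d [dmet dcomp dcomplete]]]] _.
have comeager_T_l (A : set G) : meager_in open (diffset mul inv A) ->
    comeager_in (@weak_open R G) (@T_l R G mul A).
  move=> /meager_nondecreasing[N [ndN incN AN]].
  exists (fun n => ~` spread mul inv (N n) (n.+1%:R^-1 : R)); split=> [n|mu muA].
    by apply: (nowhere_dense_not_spread dmet dcomp grp mulc invc); rewrite ?invr_gt0.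
  apply: contrapT => nmu; apply: muA; apply: (spread_T_l grp incN AN) => n.
  by apply: contrapT => mu_n; apply: nmu; exists n.
split=> [A _|A anA ngen mA|A anA nnull mA]; first exact: comeager_T_l.
- apply: ngen; split; last exact: comeager_T_l.
  exact: (analytic_univ_measurable dmet dcomp).
- have [N [ndN incN AN]] := meager_nondecreasing mA.
  apply: nnull; split; first exact: (analytic_univ_measurable dmet dcomp).
  have [mu Hmu] := spread_nonempty dmet dcomp dcomplete grp mulc invc ndN.
  by exists mu; exact: (spread_T_l grp incN AN).
Qed.
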